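(* Let $t$, $q$, $r$ be distinct primes, let $s$ be a power of $t$, and let $\alpha$ be a positive integer. Let $G$ be a subgroup of ${\rm GL}(\alpha, s)$ which is in $\mathfrak{A}_q\mathfrak{A}_r$. (i) Let $m = |F(G)|$. If $G$ is primitive, then $|G| \leq cm$, where $c$ is the multiplicative order of $s$ modulo $m$, and $c \mid \alpha$. Further $m$ is either $r$ or $q$ or $qr$. (ii) $|G| \leq (6^{1/2})^{\alpha - 1} \, d^{\alpha}$, where $d = \min\{qr, s\}$.
   Context: ${\rm GL}(\alpha,s)$ is the group of invertible $\alpha\times\alpha$ matrices over the field $\mathbb{F}_s$ with $s$ elements. $F(G)$ denotes the Fitting subgroup of $G$. For distinct primes $q,r$, $\mathfrak{A}_q\mathfrak{A}_r$ is the variety of all groups $G$ having an abelian normal subgroup $N$ of exponent dividing $q$ such that $G/N$ is abelian of exponent dividing $r$. A subgroup $G\leq {\rm GL}(\alpha,s)$ is primitive if it acts irreducibly on $V=(\mathbb{F}_s)^{\alpha}$ and there is no decomposition $V=V_1\oplus\cdots\oplus V_k$ with $k>1$ into non-zero subspaces that are permuted by $G$.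
   Formalization: The last sentence of (i), that m is r, q or qr, is stated only for G ≠ 1: the trivial group with α = 1 is primitive and lies in the variety but has m = 1. All other claims also cover trivial G. *)

(* Defs.v *)
From mathcomp Require Import all_boot all_order all_fingroup all_algebra.
From mathcomp Require Import all_solvable all_field all_character.

Set Implicit Arguments.
Unset Strict Implicit.
Unset Printing Implicit Defensive.

Import GroupScope GRing.Theory.

(* The product variety A_q A_r. *)
Definition in_AqAr (q r : nat) (gT : finGroupType) (G : {group gT}) : Prop :=
  exists N : {group gT},
    [/\ N <| G, abelian N, exponent N %| q,
        abelian (G / N) & exponent (G / N) %| r].

(* c is the least positive exponent with s ^ c = 1 modulo m.  For m = 1 this
   gives c = 1; 'Z_m is avoided because 'Z_1 is the ring of integers mod 2. *)
Definition is_mult_order (s m c : nat) : Prop :=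
  [/\ 0 < c, s ^ c = 1 %[mod m]
    & forall k, 0 < k -> s ^ k = 1 %[mod m] -> c <= k]%N.

Section LinearGroups.

Local Open Scope ring_scope.

Variables (F : finFieldType) (n : nat) (G : {group {'GL_n[F]}}).

(* Elements of {'GL_n[F]} are matrices of size n.-1.+1, which is n for n > 0.
   As everywhere in the matrix libraries, they act on row vectors by right
   multiplication. *)
Definition GL_nat (g : {'GL_n[F]}) : 'M[F]_(n.-1.+1) := GLval g.

Lemma GL_nat_repr : mx_repr G GL_nat.
Proof. by split=> [|g h _ _]. Qed.

Definition GL_natrepr : mx_representation F G n.-1.+1 :=
  MxRepresentation GL_nat_repr.

(* V is the direct sum of k > 1 nonzero subspaces W_i (given as row spaces),
   and every element of G maps each W_i onto some W_j. *)
Definition imprimitivity_decomposition (k : nat)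
    (W : 'I_k -> 'M[F]_(n.-1.+1)) : Prop :=
  [/\ (1 < k)%N,
      forall i, W i != 0,
      (\sum_i W i == 1%:M)%MS,
      mxdirect (\sum_i W i)%MS
    & forall g, g \in G ->
        forall i, exists j, (W i *m GL_nat g == W j)%MS].

Definition primitive_linear : Prop :=
  mx_irreducible GL_natrepr /\
  ~ exists (k : nat) (W : 'I_k -> 'M[F]_(n.-1.+1)),
      imprimitivity_decomposition W.

End LinearGroups.

(* Main.v *)
(* (i) By Clifford's theorem the module of a primitive G is homogeneous over the
   abelian normal subgroup A = F(G), so every nonzero element of the enveloping
   algebra of A is invertible. Hence A = <a> is cyclic and acts freely on the
   nonzero vectors, which gives m | s^alpha - 1 and c | alpha. The minimal
   polynomial f of a is irreducible; the conjugates of a are roots of f in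
   F[X]/(f), and F[X]/(f) has at most s^c elements, so |G : A| <= deg f <= c.
   (ii) Induct on alpha. By Maschke, a group that is not primitive permutes the
   blocks of a nontrivial direct decomposition. If the image of G on the k blocks
   preserves a partition of them with more than one and fewer than k parts, pass
   to the coarser decomposition; otherwise it is trivial or a metabelian
   primitive permutation group, of order at most k (k - 1) <= 6^((k - 1) / 2),
   and the kernel embeds in the product of its actions on the blocks. *)
Require Import Defs.
From mathcomp Require Import all_boot all_order all_fingroup all_algebra.
From mathcomp Require Import all_solvable all_field all_character.
From mathcomp Require Import zify.

Set Implicit Arguments.
Unset Strict Implicit.
Unset Printing Implicit Defensive.

Import GroupScope Order.TTheory GRing.Theory Num.Theory.

(** * Metabelian primitive permutation groups *)

Section PermGroups.

Variable T : finType.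
Implicit Types A H : {group {perm T}}.

Lemma perm_astabT : 'C([set: T] | 'P) = 1.
Proof.
apply/trivgP/subsetP=> g /astabP fixg; rewrite inE; apply/eqP/permP=> x.
by rewrite perm1 -[RHS](fixg x) ?inE.
Qed.

(** Every point is the image of [x] under some element of [A], and a permutation that fixes [x] and
    commutes with that element fixes the image too. *)
Lemma centraliser_atrans_astab1 A (B : {set {perm T}}) x :
  [transitive A, on [set: T] | 'P] -> B \subset 'C(A) -> B \subset 'C[x | 'P] ->
  B \subset [1].
Proof.
move=> trA cAB fixB; rewrite -perm_astabT; apply/subsetP=> g Bg; apply/astabP=> y _.
have [a Aa ->] := atransP2 trA (in_setT x) (in_setT y).
rewrite -actM -(centP (subsetP cAB g Bg) a Aa) actM.
by congr ('P%act _ a); apply/astab1P; apply: (subsetP fixB).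
Qed.

Lemma abelian_atrans_astab1 A x :
  abelian A -> [transitive A, on [set: T] | 'P] -> 'C_A[x | 'P] = 1.
Proof.
move=> abA trA; apply/trivgP; apply: (centraliser_atrans_astab1 trA).
  by rewrite subIset ?[A \subset _]abA.
exact: subsetIr.
Qed.

Lemma abelian_atrans_card A :
  abelian A -> [transitive A, on [set: T] | 'P] -> #|A| = #|T|.
Proof.
move=> abA trA; have /imsetP[x _ defT] := trA.
by rewrite -(card_orbit_stab 'P A x) abelian_atrans_astab1 // cards1 muln1 -defT cardsT.
Qed.

(** If the derived group is not transitive, it is trivial and [H] is abelian, hence regular.
    Otherwise it is regular, so the stabiliser [S] of [x] is abelian; no nontrivial element of [S]
    fixes a second point [y], so [#|S|] is the size of an orbit that avoids [x]. *)
Lemma primitive_metabelian_card H :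
    (1 < #|T|)%N -> abelian H^`(1) -> [primitive H, on [set: T] | 'P] ->
  (#|H| <= #|T| * #|T|.-1)%N.
Proof.
move=> T_gt1 abD primH; have [trH _] := andP primH.
have [|trD] := prim_trans_norm primH (der_normal 1 H).
  rewrite perm_astabT subsetI => /andP[_ /trivgP/derG1P abH].
  by rewrite abelian_atrans_card // leq_pmulr // -ltnS prednK // ltnW.
have /imsetP[x _ defT] := trH.
have [y nxy]: exists y, y != x.
  apply/existsP; rewrite -negb_forall; apply: contraL T_gt1 => /forallP eqx.
  rewrite -leqNgt -(card1 x); apply/subset_leq_card/subsetP=> z _.
  by rewrite inE eqx.
have regD := abelian_atrans_astab1 _ abD trD.
pose S := 'C_H[x | 'P]%G; pose B := 'C_S[y | 'P]%G; pose E := 'C_(H^`(1))(B)%G.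
have sSH : S \subset H := subsetIl _ _.
have abS : abelian S.
  apply/derG1P/trivgP; rewrite -(regD x) subsetI dergS //=.
  by apply: subset_trans (der_sub 1 S) _; apply: subsetIr.
have defH : S * H^`(1) = H.
  exact/(subgroup_transitiveP (in_setT x) (der_sub 1 H) trH).
(* [S] normalises [E] because it centralises [B], and the abelian derived group centralises [E]. *)
have nsEH : E <| H.
  apply/andP; split; first by rewrite subIset ?der_sub.
  rewrite -{1}defH mul_subG //.
    rewrite normsI ?(subset_trans sSH (der_norm 1 H)) //.
    apply: subset_trans (normG 'C(B)%G).
    by rewrite centsC subIset // [_ \subset 'C(_)]abS.
  apply: subset_trans (cent_sub _); rewrite centsC.
  by apply: subset_trans (subsetIl _ _) _; exact: abD.
have trE : [transitive E, on [set: T] | 'P].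
  have [|//] := prim_trans_norm primH nsEH.
  rewrite perm_astabT subsetI => /andP[_ E1].
  have [d Dd def_y] := atransP2 trD (in_setT x) (in_setT y).
  case/negP: nxy; suff Ed: d \in E.
    by have:= subsetP E1 d Ed; rewrite inE def_y => /eqP->; rewrite act1.
  rewrite inE Dd; apply/centP=> b /setIP[Sb yb].
  have [Hb xb] := setIP Sb.
  (* The commutator fixes [x] because [b] fixes both [x] and its image [y] under [d]; regularity
     makes it trivial, so [d] commutes with [b]. *)
  suff: [~ d^-1, b^-1] \in 'C_(H^`(1))[x | 'P].
    rewrite regD => /set1P/eqP/commgP/commuteV/commute_sym/commuteV.
    by rewrite !invgK => /commute_sym.
  rewrite inE; apply/andP; split.
    by rewrite commgEl groupM ?invgK // memJ_norm ?groupV // (subsetP (der_norm 1 H)).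
  apply/astab1P; rewrite commgEl conjgE !invgK !actM -def_y (astab1P yb) def_y actK.
  by rewrite -{1}(astab1P xb) actK.
have B1 : B :=: 1.
  apply/trivgP; apply: (centraliser_atrans_astab1 trE).
    by rewrite centsC subsetIr.
  by rewrite /= /S; apply: subset_trans (subsetIl _ _) (subsetIr _ _).
have := card_orbit_stab 'P S y.
rewrite -[_ :&: 'C[y | _]]/(gval B) B1 cards1 muln1 => cardS.
rewrite -(card_orbit_stab 'P H x) -defT cardsT leq_mul2l -/S -cardS.
apply/orP; right; rewrite -(cardC1 x); apply/subset_leq_card/subsetP=> z.
case/imsetP=> s /setIP[Hs xs] ->; rewrite !inE -[X in _ != X](astab1P xs).
by rewrite (inj_eq (act_inj _ _)).
Qed.

End PermGroups.

(** * The variety A_q A_r *)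

Section ProductVariety.

Variables q r : nat.

(** Membership in terms of elements lets subgroups and homomorphic images be treated without
    quotient groups. *)
Lemma in_AqArP (gT : finGroupType) (G : {group gT}) :
  in_AqAr q r G <->
  exists N : {group gT},
    [/\ N <| G, abelian N, {in N, forall x, x ^+ q = 1}, G^`(1) \subset N
      & {in G, forall x, x ^+ r \in N}].
Proof.
split=> [[N [nsNG abN eN abGN eGN]] | [N [nsNG abN eN dGN eGN]]];
  have [sNG nNG] := andP nsNG; exists N; split=> //.
- exact/exponentP.
- by rewrite der1_min.
- move=> x Gx; have Nx := subsetP nNG x Gx.
  apply/(coset_idr (groupX _ Nx)); rewrite morphX //.
  by apply: (exponentP eGN); apply: mem_quotient.
- exact/exponentP.
- exact: sub_der1_abelian.
apply/exponentP=> _ /morphimP[x Nx Gx ->].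
by rewrite -morphX //; apply/coset_id/eGN.
Qed.

Lemma in_AqAr_sub (gT : finGroupType) (G H : {group gT}) :
  H \subset G -> in_AqAr q r G -> in_AqAr q r H.
Proof.
move=> sHG /in_AqArP[N [nsNG abN eN dGN eGN]]; apply/in_AqArP.
exists (N :&: H)%G; split.
- by rewrite /= setIC; apply: normalGI nsNG.
- exact: abelianS (subsetIl _ _) abN.
- by move=> x /setIP[/eN].
- by rewrite subsetI der_sub (subset_trans (dergS 1 sHG)).
by move=> x Hx; rewrite inE eGN ?(subsetP sHG) ?groupX.
Qed.

Lemma in_AqAr_morphim (aT rT : finGroupType) (D : {group aT})
    (f : {morphism D >-> rT}) (G : {group aT}) :
  G \subset D -> in_AqAr q r G -> in_AqAr q r (f @* G)%G.
Proof.
move=> sGD /in_AqArP[N [nsNG abN eN dGN eGN]]; apply/in_AqArP.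
exists (f @* N)%G; split.
- exact: morphim_normal.
- exact: morphim_abelian.
- by move=> _ /morphimP[x Dx Nx ->]; rewrite -morphX // eN ?morph1.
- by rewrite /= -morphim_der // morphimS.
by move=> _ /morphimP[x Dx Gx ->]; rewrite -morphX // mem_morphim ?eGN // groupX.
Qed.

Lemma in_AqAr_der1_abelian (gT : finGroupType) (G : {group gT}) :
  in_AqAr q r G -> abelian G^`(1).
Proof. by case/in_AqArP=> N [_ abN _ sGN _]; apply: abelianS abN. Qed.

Lemma in_AqAr_solvable (gT : finGroupType) (G : {group gT}) :
  in_AqAr q r G -> solvable G.
Proof.
by case=> N [nsNG abN _ abGN _]; rewrite (series_sol nsNG) !abelian_sol.
Qed.

Lemma in_AqAr_exponent (gT : finGroupType) (G : {group gT}) :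
  in_AqAr q r G -> exponent G %| (q * r)%N.
Proof.
case/in_AqArP=> N [_ _ eN _ eGN]; apply/exponentP=> x /eGN Nx.
by rewrite mulnC expgM eN.
Qed.

Hypotheses (q_pr : prime q) (r_pr : prime r) (neq_qr : q <> r).

(* All Sylow subgroups of a group in A_q A_r are abelian. *)
Lemma in_AqAr_nilpotent_abelian (gT : finGroupType) (A : {group gT}) :
  in_AqAr q r A -> nilpotent A -> abelian A.
Proof.
case=> N [nsNA abN eN abAN eAN] nilA.
have qN: q.-group N.
  by rewrite -pnat_exponent; apply: pnat_dvd eN _; rewrite pnat_id.
have rAN: r.-group (A / N).
  by rewrite -pnat_exponent; apply: pnat_dvd eAN _; rewrite pnat_id.
(* As [A / N] is an [r]-group, [N] is the Sylow [q]-subgroup of [A], and the complementary core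
   embeds in the abelian group [A / N]. *)
have hallN: q.-Hall(A) N.
  rewrite /pHall normal_sub // qN -card_quotient ?normal_norm //=.
  by apply: sub_in_pnat rAN => p _ /eqP->; rewrite !inE; apply/eqP=> /esym.
have defA := nilpotent_pcoreC q nilA.
rewrite -(dprodW defA) abelianM.
have -> : abelian 'O_q(A) by rewrite -(normal_Hall_pcore hallN nsNA) in abN *.
have -> /=: abelian 'O_q^'(A).
  have tiN : N :&: 'O_q^'(A) = 1.
    by apply: coprime_TIg; apply: pnat_coprime (pcore_pgroup _ _).
  rewrite (isog_abelian (quotient_isog _ tiN)).
    by apply: abelianS abAN; apply: quotientS; apply: pcore_sub.
  exact: subset_trans (pcore_sub _ _) (normal_norm nsNA).
by case/dprodP: defA.
Qed.

End ProductVariety.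

(** * Homogeneity of primitive representations *)

Section Decompositions.

Local Open Scope ring_scope.

Variables (F : fieldType) (gT : finGroupType) (G : {group gT}) (n : nat).
Variable rG : mx_representation F G n.

(** Any finite index type is allowed, so that socle components, booleans and parts of a partition
    can index blocks. *)
Definition decomposition (I : finType) (W : I -> 'M[F]_n) :=
  [/\ (1 < #|I|)%N, forall i, W i != 0, (\sum_i W i :=: 1%:M)%MS,
      mxdirect (\sum_i W i)
    & forall g, g \in G -> forall i, exists j, (W i *m rG g :=: W j)%MS].

Definition primitive_repr :=
  mx_irreducible rG /\ forall (I : finType) (W : I -> 'M[F]_n), ~ decomposition W.

End Decompositions.

Section Homogeneous.

Local Open Scope ring_scope.

Variables (F : fieldType) (gT : finGroupType) (G A : {group gT}) (n : nat).
Variable rG : mx_representation F G n.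
Hypotheses (primG : primitive_repr rG) (nsAG : A <| G).
Let irrG : mx_irreducible rG := primG.1.
Let rA := subg_repr rG (normal_sub nsAG).

(** By Clifford, [G] permutes the homogeneous components of the restriction to [A], and their direct
    sum is the whole space; two distinct components would give a decomposition. *)
Lemma primitive_homogeneous M N : mxsimple rA M -> mxsimple rA N -> mx_iso rA M N.
Proof.
move=> simM simN; apply/component_mx_isoP=> //.
apply: (@socle_exists _ _ _ _ rA) => sA.
pose WM := PackSocle (component_socle sA simM).
pose WN := PackSocle (component_socle sA simN).
rewrite -(PackSocleK (component_socle sA simM)) -/WM.
rewrite -(PackSocleK (component_socle sA simN)) -/WN.
have [-> //|neqMN] := eqVneq WM WN.
case: (primG.2 sA (fun W => socle_val W)); split.
- by rewrite (cardD1 WM) (cardD1 WN) !inE eq_sym neqMN.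
- by move=> W; apply: contraNneq (nz_socle W) => ->.
- by have := Clifford_Socle1 irrG sA; rewrite /Socle => ->.
- exact: Socle_direct.
move=> g Gg W; exists ('Cl%act W g).
by apply: eqmx_sym; apply: val_Clifford_act.
Qed.

(** A nonzero kernel of [B] is an [A]-submodule and contains a simple [M]. All simple submodules are
    isomorphic to [M], so [B], lying in the enveloping algebra, kills them all, and they span the
    space. *)
Lemma primitive_envelop_unit B :
  (B \in enveloping_algebra_mx rA)%MS -> centgmx rA B -> B != 0 -> B \in unitmx.
Proof.
move=> envB cenB; apply: contraR; rewrite -row_free_unit -kermx_eq0 => nzK.
have modK := kermx_centg_module cenB.
apply: (mxsimple_exists modK nzK) => [[M simM sMK]].
apply: (@socle_exists _ _ _ _ rA) => sA.
have MB0 : M *m B = 0 by apply/sub_kermxP.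
rewrite -[B]mul1mx -submx0 -(Clifford_Socle1 irrG sA) sumsmxMr.
apply/sumsmx_subP=> W _; rewrite submx0.
rewrite /socle_val; have [I [V isoV ->]] := component_mx_def (socle_simple W).
rewrite -submx0 sumsmxMr; apply/sumsmx_subP=> i _; rewrite submx0.
have simV := mx_iso_simple (isoV i) (socle_simple W).
have [f injf homf defV] := primitive_homogeneous simM simV.
rewrite -submx0 -(eqmxMr B defV) -(hom_envelop_mxC homf envB).
by rewrite MB0 mul0mx sub0mx.
Qed.

End Homogeneous.

(** * Roots of an irreducible polynomial over a finite field *)

Section IrreducibleRoots.

Local Open Scope ring_scope.

Variables (F : finFieldType) (f : {poly F}).
Hypotheses (f_monic : f \is monic) (f_irr : irreducible_poly f).

Lemma quotient_field : exists (K : finFieldType) (pi : {rmorphism {poly F} -> K}),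
  [/\ #|K| = (#|F| ^ (size f).-1)%N, forall p, (pi p == 0) = (f %| p)
    & forall y, exists p, y = pi p].
Proof.
pose h : monic_irreducible_poly f := (f_irr, f_monic).
exists {poly %/ f with h}, (in_qpoly f); split; first exact: card_qfpoly.
  move=> p; rewrite -val_eqE /= mk_monicE //.
  by rewrite -Pdiv.IdomainMonic.modpE.
move=> y; exists (val y); apply/val_inj; rewrite /= Pdiv.CommonRing.rmodp_small //.
exact: size_mk_monic.
Qed.

(* If f is irreducible, f | X^(s^c) - X forces deg f <= c, and in F[X]/(f) the
   powers X^i with f | f(X^i) are roots of f. *)
Lemma irreducible_power_roots (N c : nat) (I : {set 'I_N}) :
    (0 < c)%N -> f %| 'X^(#|F| ^ c) - 'X ->
    {in I, forall i : 'I_N, f %| f \Po 'X^i} ->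
    {in I &, forall i j : 'I_N, f %| 'X^i - 'X^j -> i = j} ->
  (#|I| <= c)%N.
Proof.
move=> c_gt0 fXc fXI injI; have [K [pi [cardK ker_pi surj_pi]]] := quotient_field.
have [p p_pr /= charF] := finPcharP F.
have charK : p \in [pchar K].
  by rewrite inE p_pr /= -(rmorph_nat pi) -(rmorph_nat polyC) (pcharf0 charF) !rmorph0.
have F_gt1 : (1 < #|F|)%N := finNzRing_gt1 F.
(* Raising to the power [#|F| ^ c] is a ring endomorphism of [K] that fixes the image of [F] and the
   image of ['X], which generate [K]. *)
have Frob (y : K) : y ^+ (#|F| ^ c) = y.
  have pF : [pchar K].-nat (#|F| ^ c)%N.
    have -> : #|F| = (p ^ _)%N := card_pprimeChar charF.
    by rewrite !pnatX (eq_pnat _ (pcharf_eq charK)) pnat_id.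
  have [a ->] := surj_pi y; elim/poly_ind: a => [|a b IHa].
    by rewrite rmorph0 expr0n expn_eq0 (gtn_eqF (ltnW F_gt1)).
  rewrite rmorphD rmorphM exprDn_pchar // exprMn IHa -!rmorphXn.
  congr (_ * _ + pi _).
    by apply/eqP; rewrite -subr_eq0 -rmorphB ker_pi.
  congr (_%:P); elim: (c) => [|k IHk]; first by rewrite expr1.
  by rewrite expnS exprM expf_card.
have f_gt1 : (1 < size f)%N := f_irr.1.
have fn0 : f != 0 by rewrite -size_poly_gt0 ltnW.
(* All [#|F| ^ (size f).-1] elements of [K] are roots of a polynomial of degree [#|F| ^ c]. *)
have leqc : ((size f).-1 <= c)%N.
  have szX : size ('X^(#|F| ^ c) - 'X : {poly K}) = (#|F| ^ c).+1.
    rewrite size_polyDl ?size_polyXn // size_polyN size_polyX ltnS.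
    by rewrite -(ltn_exp2l 0 c F_gt1) expn0 in c_gt0; exact: c_gt0.
  rewrite -(leq_exp2l _ _ F_gt1) -cardK -ltnS -szX cardE.
  apply: max_poly_roots (enum_uniq _); first by rewrite -size_poly_eq0 szX.
  by apply/allP=> y _; rewrite rootE !hornerE Frob subrr.
apply: leq_trans leqc; rewrite -ltnS prednK ?(ltnW f_gt1) //.
have [n0|[i0 Ii0]] := set_0Vmem I; first by rewrite n0 cards0 ltnW.
pose fK := map_poly (pi \o polyC) f.
have <- : size fK = size f by apply: size_map_poly.
have -> : #|I| = size [seq pi 'X^i | i : 'I_N <- enum I] by rewrite size_map cardE.
apply: max_poly_roots; first by rewrite map_poly_eq0.
  apply/allP=> _ /mapP[i + ->]; rewrite mem_enum => Ii; rewrite rootE.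
  have := fXI i Ii; rewrite -ker_pi comp_polyE rmorph_sum horner_coef size_map_poly.
  congr (_ == 0); apply: eq_bigr => j _.
  by rewrite -mul_polyC rmorphM rmorphXn coef_map.
rewrite map_inj_in_uniq ?enum_uniq // => i j; rewrite !mem_enum => Ii Ij eqij.
by apply: injI => //; rewrite -ker_pi rmorphB eqij subrr.
Qed.

End IrreducibleRoots.

Lemma horner_mx_power_comp (F : fieldType) n (B : 'M[F]_n.+1) p i :
  (horner_mx B (p \Po 'X^i) = horner_mx (B ^+ i) p)%R.
Proof.
elim/poly_ind: p => [|p c IHp]; first by rewrite comp_poly0 !rmorph0.
rewrite comp_polyD comp_polyM comp_polyX comp_polyC !rmorphD !rmorphM /= IHp.
by rewrite rmorphXn /= !horner_mx_C !horner_mx_X.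
Qed.

(** * Abelian normal subgroups of faithful primitive groups *)

Section PrimitiveFaithful.

Local Open Scope ring_scope.

Variables (F : finFieldType) (gT : finGroupType) (G A : {group gT}) (n : nat).
Variable rG : mx_representation F G n.+1.
Hypotheses (primG : primitive_repr rG) (injG : mx_faithful rG).
Hypotheses (nsAG : A <| G) (abA : abelian A).
Let sAG := normal_sub nsAG.
Let rA := subg_repr rG sAG.

(** Since [A] is abelian, its enveloping algebra is commutative, so centrality is automatic. *)
Let envelop_unit B :
  (B \in enveloping_algebra_mx rA)%MS -> B != 0 -> B \in unitmx.
Proof.
move=> envB; apply: (primitive_envelop_unit primG envB); apply/centgmxP=> a Aa.
have /envelop_mxP[b ->] := envB.
rewrite mulmx_suml mulmx_sumr; apply: eq_bigr => x Ax.
rewrite -scalemxAl -scalemxAr -!repr_mxM ?(subsetP sAG) //.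
by rewrite (centsP abA).
Qed.

Let subr1_unit a : a \in A^#%g -> rG a - 1 \is a GRing.unit.
Proof.
case/setD1P=> nta Aa; apply: envelop_unit.
  by rewrite linearB /= addmx_sub ?eqmx_opp ?(envelop_mx_id rA Aa) ?envelop_mx1.
rewrite subr_eq0; apply: contraNneq nta => rGa1; rewrite -in_set1.
by apply: (subsetP injG); rewrite inE (subsetP sAG) //= mul1mx rGa1.
Qed.

Lemma primitive_abelian_cyclic : cyclic A.
Proof.
apply: (div_ring_mul_group_cyclic (repr_mx1 rA)) (repr_mxM rA) _ abA.
exact: subr1_unit.
Qed.

(** A nontrivial [a] fixes no nonzero vector because [rG a - 1] is invertible; hence all orbits of
    [A] on nonzero vectors have size [#|A|]. *)
Lemma primitive_card_dvd : (#|A| %| (#|F| ^ n.+1).-1)%N.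
Proof.
have -> : (#|F| ^ n.+1).-1 = #|[set~ (0 : 'rV[F]_n.+1)]|.
  by rewrite cardsC1 card_mx mul1n.
have actA : [acts A, on [set~ (0 : 'rV_n.+1)] | 'MR rA].
  apply/subsetP=> a Aa; rewrite !inE Aa /=; apply/subsetP=> v.
  rewrite !inE /= mx_repr_actE //; apply: contra.
  by rewrite -{1}(mul0mx _ (rA a)) (can_eq (repr_mxK rA Aa)).
rewrite -(acts_sum_card_orbit actA); apply: dvdn_sum => _ /imsetP[v nzv ->].
rewrite card_orbit_in // (_ : 'C_A[v | _] = 1)%g ?indexg1 //.
apply/trivgP/subsetP=> a /setIP[Aa /astab_act/(_ (set11 v))/=].
rewrite mx_repr_actE //= => va.
rewrite inE; apply: contraLR nzv => nta; rewrite !inE negbK.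
have Ua : rG a - 1 \in unitmx by apply: subr1_unit; rewrite !inE nta.
by rewrite -[v](mulmxK Ua) mulmxBr mulmx1 va subrr mul0mx.
Qed.

Lemma primitive_index_le c :
  (0 < c)%N -> #|F| ^ c = 1 %[mod #|A|] -> 'C_G(A) \subset A -> (#|G : A| <= c)%N.
Proof.
move=> c_gt0 Fc cAG; have [a defA] := cyclicP primitive_abelian_cyclic.
have Aa : a \in A by rewrite defA cycle_id.
have Ga := subsetP sAG a Aa.
pose x := rG a; pose f := mxminpoly x.
have dvd_f p : f %| p = (horner_mx x p == 0) by rewrite dvd_mxminpoly.
have env_x p : (horner_mx x p \in enveloping_algebra_mx rA)%MS.
  elim/poly_ind: p => [|p b IHp]; first by rewrite rmorph0 linear0 sub0mx.
  rewrite rmorphD rmorphM /= horner_mx_X horner_mx_C linearD addmx_sub //.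
    exact: envelop_mxM IHp (envelop_mx_id rA Aa).
  by rewrite -scalemx1 linearZ scalemx_sub ?envelop_mx1.
(* If [p] divides [f] and [p(x)] is nonzero, then [p(x)] is a unit, so the cofactor annihilates [x]
   and is a multiple of [f]; by degrees [p] is constant. *)
have f_irr : irreducible_poly f.
  split=> [|p p1 p_dv_f]; first by rewrite size_mxminpoly ltnS mxminpoly_nonconstant.
  rewrite /eqp p_dv_f dvd_f; have [//|nz_px] := eqVneq.
  have Up := envelop_unit (env_x p) nz_px.
  have /dvdpP[p' def_f] := p_dv_f.
  have f_dv_p' : f %| p'.
    rewrite dvd_f -(mulmxK Up (horner_mx x p')) -[_ *m horner_mx x p]rmorphM.
    by rewrite -def_f /= mx_root_minpoly mul0mx.
  have := mxminpoly_monic x => /monic_neq0; rewrite -/f def_f mulf_eq0 => /norP[nzp' nzp].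
  have := dvdp_leq nzp' f_dv_p'; rewrite def_f size_mul // leqNgt.
  case: (size p) (size_poly_gt0 p) p1 => [|[|k]]; rewrite ?nzp // => _ _.
  by rewrite !addnS /= ltnS leq_addr.
pose I : {set 'I_#|A|} := [set i : 'I_#|A| | a ^+ i \in a ^: G]%g.
(* As [a] generates [A] and ['C_G(A)] lies in [A], the centraliser of [a] in [G] is [A], and the
   index counts conjugates of [a]. *)
have -> : #|G : A| = #|(a ^: G)%g|.
  rewrite -index_cent1; congr #|_ : _|; apply/eqP; rewrite eqEsubset.
  rewrite subsetI sAG sub_cent1 (subsetP abA) //=.
  by rewrite -cent_cycle -defA.
apply: leq_trans (_ : #|I| <= c)%N.
  have/subset_leq_card/leq_trans-> //:
      (a ^: G)%g \subset [set (a ^+ (i : 'I__))%g | i in I].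
    apply/subsetP=> b aGb.
    have Ab : b \in A.
      by case/imsetP: aGb => g Gg ->; rewrite memJ_norm ?(subsetP (normal_norm nsAG)).
    have/cyclePmin[i]: b \in <[a]>%g by rewrite -defA.
    rewrite orderE -defA => lti def_b; apply/imsetP; exists (Ordinal lti) => //.
    by rewrite inE -def_b.
  exact: leq_imset_card.
have xX i : x ^+ i = rG (a ^+ i)%g.
  elim: i => [|i IHi]; first by rewrite expg0 repr_mx1.
  by rewrite exprS expgS repr_mxM ?groupX // IHi.
apply: (irreducible_power_roots (mxminpoly_monic x) f_irr c_gt0).
- rewrite -/f dvd_f rmorphB rmorphXn /= horner_mx_X xX.
  have/eqP -> : (a ^+ (#|F| ^ c) == a ^+ 1)%g.
    by rewrite eq_expg_mod_order orderE -defA Fc.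
  by rewrite expg1 subrr.
(* The value of [f(X^i)] at [x] is [f(x^i)], which is conjugate to [f(x) = 0] because [x^i] is
   conjugate to [x]. *)
- move=> i; rewrite inE => /imsetP[g Gg ai]; rewrite -/f dvd_f horner_mx_power_comp.
  rewrite xX ai conjgE !repr_mxM ?groupM ?groupV // repr_mxV // mulmxA.
  by rewrite horner_mx_uconjC ?repr_mx_unit // mx_root_minpoly mulmx0 mul0mx.
move=> i j _ _; rewrite -/f dvd_f rmorphB !rmorphXn /= horner_mx_X !xX subr_eq0.
move/eqP/(mx_faithful_inj injG) => /(_ (groupX _ Ga) (groupX _ Ga))/eqP.
rewrite eq_expg_mod_order orderE -defA !modn_small // => /eqP; exact: val_inj.
Qed.

End PrimitiveFaithful.

(** * Primitive representations of groups in A_q A_r *)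

Lemma exp_modn_mul s m c k : s ^ c = 1 %[mod m] -> s ^ (k * c) = 1 %[mod m].
Proof. by move=> sc1; rewrite mulnC expnM -modnXm sc1 modnXm exp1n. Qed.

(* The centraliser has class at most 2: its derived group lies in the abelian
   normal subgroup G^`(1), hence in 'F(G). *)
Lemma metabelian_cent_sub_Fitting (gT : finGroupType) (G : {group gT}) :
  abelian G^`(1) -> 'C_G('F(G)) \subset 'F(G).
Proof.
move=> abG'; have sG'F : G^`(1) \subset 'F(G).
  by apply: Fitting_max; rewrite ?der_normal ?abelian_nil.
apply: Fitting_max; first by rewrite /normal subsetIl normsI ?normG ?norms_cent ?gFnorm.
apply/lcnP; exists 2; rewrite !lcnSn lcn1; apply/commG1P.
apply: subset_trans (dergS 1 (subsetIl _ _)) _; rewrite centsC.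
by apply: subset_trans (subsetIr _ _) (centS sG'F).
Qed.

(** This absorbs the factor [c], at most the dimension [k.+1], into the power of 6; squaring keeps
    the square root of 6 out of the naturals. *)
Lemma sqrS_le_exp6 k : (k.+1 ^ 2 <= 6 ^ k)%N.
Proof.
elim: k => // k IHk; rewrite [(6 ^ _)%N]expnS; apply: leq_trans (leq_mul (leqnn 6) IHk).
apply: leq_trans (_ : (2 * k.+1) ^ 2 <= _)%N; first by rewrite leq_exp2r //; lia.
by rewrite expnMn leq_mul.
Qed.

Lemma mult_order_exists s m :
  (0 < m)%N -> coprime s m -> exists c, is_mult_order s m c.
Proof.
move=> m_gt0 co_sm; pose P c := (0 < c)%N && (s ^ c == 1 %[mod m]).
have exP : exists c, P c.
  exists (totient m); rewrite /P totient_gt0 m_gt0; apply/eqP.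
  exact: Euler_exp_totient.
case: (ex_minnP exP) => c /andP[c_gt0 /eqP sc1] min_c; exists c; split=> // k k_gt0 sk1.
by apply: min_c; rewrite /P k_gt0 sk1 eqxx.
Qed.

Lemma mult_order_dvd s m c k :
  is_mult_order s m c -> s ^ k = 1 %[mod m] -> (c %| k)%N.
Proof.
case=> c_gt0 sc1 min_c sk1; rewrite /dvdn; case: posnP => // k_gt0.
have /min_c/(_ _)/idPn[] // := k_gt0; last by rewrite -ltnNge ltn_mod.
by rewrite -[RHS]sk1 [in RHS](divn_eq k c) expnD -modnMml exp_modn_mul // modnMml mul1n.
Qed.

Section AqAr.

Variables (q r : nat) (F : finFieldType).
Hypotheses (q_pr : prime q) (r_pr : prime r) (neq_qr : q <> r).
Hypotheses (qF : q \notin [pchar F]%R) (rF : r \notin [pchar F]%R).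

Lemma in_AqAr_pchar' (gT : finGroupType) (G : {group gT}) :
  in_AqAr q r G -> [pchar F]%R^'.-group G.
Proof.
move=> GAqAr; rewrite -pnat_exponent; apply: pnat_dvd (in_AqAr_exponent GAqAr) _.
by rewrite pnatM !pnatE // !inE qF rF.
Qed.

Lemma in_AqAr_coprime_card (gT : finGroupType) (G : {group gT}) :
  in_AqAr q r G -> coprime #|F| #|G|.
Proof.
move=> /in_AqAr_pchar' F'G; have [p p_pr /= pF] := finPcharP F.
have -> : #|F| = (p ^ _)%N := card_pprimeChar pF.
apply: pnat_coprime (F'G); rewrite pnatX (eq_pnat _ (pcharf_eq pF)) pnat_id //.
Qed.

Section Primitive.

Variables (gT : finGroupType) (G : {group gT}) (n : nat).
Variable rG : mx_representation F G n.+1.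
Hypotheses (GAqAr : in_AqAr q r G) (primG : primitive_repr rG).
Hypothesis injG : mx_faithful rG.

Let nsFG : 'F(G) <| G := Fitting_normal G.
Let abF : abelian 'F(G).
Proof.
apply: (in_AqAr_nilpotent_abelian q_pr r_pr neq_qr) (Fitting_nil G).
exact: in_AqAr_sub (normal_sub nsFG) GAqAr.
Qed.

Lemma primitive_Fitting_order :
  exists2 c, is_mult_order #|F| #|'F(G)| c
           & (#|G| <= c * #|'F(G)|)%N /\ (c %| n.+1)%N.
Proof.
have coF : coprime #|F| #|'F(G)|.
  exact: in_AqAr_coprime_card (in_AqAr_sub (normal_sub nsFG) GAqAr).
have [c c_ord] := mult_order_exists (cardG_gt0 _) coF.
exists c => //; have [c_gt0 Fc _] := c_ord; split.
  rewrite -(Lagrange (normal_sub nsFG)) mulnC leq_mul2r.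
  rewrite (primitive_index_le primG injG nsFG abF c_gt0 Fc) ?orbT //.
  exact: metabelian_cent_sub_Fitting (in_AqAr_der1_abelian GAqAr).
apply: mult_order_dvd c_ord _; apply/eqP.
rewrite eqn_mod_dvd ?expn_gt0 ?(ltnW (finNzRing_gt1 F)) // subn1.
exact: primitive_card_dvd primG injG nsFG abF.
Qed.

Lemma primitive_Fitting_dvd : (#|'F(G)| %| q * r)%N.
Proof.
have cycF := primitive_abelian_cyclic primG injG nsFG abF.
rewrite -(exponent_cyclic cycF).
exact: dvdn_trans (exponentS (normal_sub nsFG)) (in_AqAr_exponent GAqAr).
Qed.

(** A nontrivial solvable group has a nontrivial Fitting subgroup, which excludes the divisor 1 of
    [q * r]; the trivial group, primitive in dimension one, does give 1. *)
Lemma primitive_Fitting_card :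
  G :!=: 1 -> [\/ #|'F(G)| = r, #|'F(G)| = q | #|'F(G)| = (q * r)%N].
Proof.
move=> ntG; have := primitive_Fitting_dvd.
have : #|'F(G)| != 1%N.
  by rewrite -trivg_card1 trivg_Fitting // (in_AqAr_solvable GAqAr).
move: #|_| => m; have [q_m|] := boolP (q %| m)%N.
  case/dvdnP: q_m => k ->; rewrite mulnC dvdn_pmul2l ?prime_gt0 // => _.
  have [_ /(_ k) r_div] := primeP r_pr => /r_div/orP[]/eqP->; rewrite ?muln1.
    by constructor 2.
  by constructor 3.
rewrite -prime_coprime // => co_qm m1; rewrite Gauss_dvdr 1?coprime_sym //.
have [_ /(_ m) r_div] := primeP r_pr => /r_div/orP[]/eqP mE; last by constructor 1.
by rewrite mE in m1.
Qed.

Lemma primitive_card_bound :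
  (#|G| ^ 2 <= 6 ^ n * minn (q * r) #|F| ^ (2 * n.+1))%N.
Proof.
have [c _ [leG c_n]] := primitive_Fitting_order.
have F_gt1 := finNzRing_gt1 F.
have qr_gt0 : (0 < q * r)%N by rewrite muln_gt0 !prime_gt0.
(* The order of ['F(G)] divides both [q * r] and [(#|F| ^ n.+1).-1]; each branch of the minimum uses
   one of these. *)
have leF : (#|'F(G)| <= minn (q * r) #|F| ^ n.+1)%N.
  rewrite /minn; case: ifP => _.
    apply: leq_trans (dvdn_leq qr_gt0 primitive_Fitting_dvd) _.
    by rewrite -{1}[(q * r)%N]expn1 leq_pexp2l.
  apply: leq_trans (leq_pred _).
  apply: dvdn_leq; last exact: primitive_card_dvd primG injG nsFG abF.
  have := ltn_exp2l 0 n.+1 F_gt1; rewrite expn0 => /esym Fn_gt1.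
  by rewrite -ltnS prednK -?Fn_gt1 // ltnW -?Fn_gt1.
have leC : (c ^ 2 <= 6 ^ n)%N.
  apply: leq_trans (sqrS_le_exp6 n); rewrite leq_exp2r //.
  exact: dvdn_leq c_n.
have leF2 : (#|'F(G)| ^ 2 <= minn (q * r) #|F| ^ (2 * n.+1))%N.
  by rewrite [(2 * _)%N]mulnC expnM leq_exp2r.
have := leG; rewrite -(leq_exp2r _ _ (ltn0Sn 1)) expnMn => /leq_trans; apply.
exact: leq_mul leC leF2.
Qed.

End Primitive.
End AqAr.

(** * Bounds for orders and indices *)

(** Equality at [k = 3], the case of the symmetric group of degree 3, is the source of the constant
    6. *)
Lemma sqr_pred_mul_le_exp6 k : (1 < k)%N -> ((k * k.-1) ^ 2 <= 6 ^ k.-1)%N.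
Proof.
(* The left side grows by the factor [((k + 1) / (k - 1))^2], which is 9 at [k = 2] but at most 4
   from [k = 3] on, where the induction starts. *)
case: k => [|[|[|k]]] // _; elim: k => [|k IHk] //.
rewrite [in leqRHS]/= expnS; apply: leq_trans (leq_mul (leqnn 6) IHk).
rewrite /= !expnMn -!mulnn; nia.
Qed.

Lemma leq_index_mul (gT : finGroupType) (G H K : {group gT}) :
  K \subset G -> (#|G : H| <= #|G : K| * #|K : H|)%N.
Proof.
move=> sKG; rewrite -(indexgI K H) Lagrange_index ?subsetIl //.
by apply: dvdn_leq; rewrite ?indexgS ?subsetIr.
Qed.

(** Intersecting with one more [K i] multiplies the index by at most [#|G : K i|]. *)
Lemma leq_index_bigcap (gT : finGroupType) (I : finType) (G H : {group gT})
    (K : I -> {group gT}) :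
  \bigcap_i K i \subset H -> (#|G : H| <= \prod_i #|G : K i|)%N.
Proof.
move=> sKH.
have [L sLK leL]: exists2 L : {group gT}, {in index_enum I, forall i, L \subset K i}
    & (#|G : L| <= \prod_i #|G : K i|)%N.
  elim: (index_enum I) => [|i s [L sLK leL]].
    by exists G; rewrite // big_nil indexgg.
  exists (K i :&: L)%G.
    move=> j; rewrite inE => /predU1P[-> | /sLK]; first exact: subsetIl.
    exact: subset_trans (subsetIr _ _).
  rewrite big_cons -(indexgI _ (K i :&: L)) setIA.
  rewrite -(Lagrange_index (subsetIl _ _) (subsetIl _ _)) !indexgI leq_mul //.
  by apply: leq_trans leL; apply/subset_leq_card/imsetS/subsetIl.
apply: leq_trans leL; apply: dvdn_leq; rewrite // indexgS //.
by apply: subset_trans sKH; apply/bigcapsP=> i _; rewrite sLK ?mem_index_enum.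
Qed.

(** An imprimitive transitive group preserves a block system, and a nontrivial intransitive one its
    orbit partition; the trivial group satisfies the order bound. *)
Lemma metabelian_perm_card (T : finType) (H : {group {perm T}}) :
    (1 < #|T|)%N -> abelian H^`(1) ->
  (#|H| <= #|T| * #|T|.-1)%N \/
  exists Q : {set {set T}}, [/\ partition Q [set: T],
    {in Q & H, forall (B : {set T}) (h : {perm T}), h @: B \in Q} & (1 < #|Q| < #|T|)%N].
Proof.
move=> T_gt1 abH'.
have [primH | ] := boolP [primitive H, on [set: T] | 'P].
  by left; apply: primitive_metabelian_card.
rewrite negb_and negbK; have [trH /=|ntrH _] := boolP [transitive H, on _ | _].
  case/existsP=> Q /and3P[partQ actQ]; rewrite cardsT => cardQ; right.
  by exists Q; split=> // B h QB Hh; have := actsP actQ h Hh B; rewrite QB.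
have [-> | ntH] := eqVneq H 1%G.
  by left; rewrite cards1 muln_gt0 ltnW //= -ltnS prednK // ltnW.
have actT : [acts H, on [set: T] | 'P] by apply/actsP=> h _ x; rewrite !inE.
right; exists (orbit 'P H @: [set: T]); split.
- exact: orbit_partition actT.
- move=> _ h /imsetP[x _ ->] Hh; apply/imsetP; exists x => //.
  by apply: etrans (setact_orbit 'P H x h) _; rewrite conjGid ?orbit_act.
apply/andP; split.
  move: ntrH; rewrite atrans_acts_card actT /= => nt1.
  rewrite ltn_neqAle eq_sym nt1 /=.
  have [x _] : exists x : T, true.
    by move: (ltnW T_gt1); rewrite -cardsT card_gt0 => /set0Pn[x _]; exists x.
  by rewrite card_gt0; apply/set0Pn; exists (orbit 'P H x); apply: imset_f.
rewrite -cardsT ltn_neqAle leq_imset_card andbT.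
(* If there were as many orbits as points, all orbits would be singletons and [H] trivial. *)
apply: contra ntH => /imset_injP inj_orb.
rewrite -val_eqE /= -subG1; apply/subsetP=> h Hh; rewrite inE; apply/eqP/permP=> x.
rewrite perm1; apply: inj_orb => //; by apply: etrans (orbit_act 'P x Hh).
Qed.

(** * Permutation of the blocks of a decomposition *)

Section BlockAction.

Local Open Scope ring_scope.

Variables (F : fieldType) (gT : finGroupType) (G : {group gT}) (n : nat).
Variables (rG : mx_representation F G n) (I : finType) (W : I -> 'M[F]_n).
Hypothesis decW : decomposition rG W.

Lemma decomposition_inj i j : (W i <= W j)%MS -> i = j.
Proof.
case: decW => _ nzW _ /mxdirect_sumsP dxW _ sWij.
apply/eqP; apply: contraNT (nzW i) => neq_ij.
rewrite -submx0 -(dxW i isT) sub_capmx submx_refl /=.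
by apply: submx_trans sWij (sumsmx_sup j _ _); rewrite //= eq_sym.
Qed.

Lemma decomposition_rank : (\sum_i \rank (W i) = n)%N.
Proof.
case: decW => _ _ sumW /mxdirectP /= dxW _.
by rewrite -dxW sumW mxrank1.
Qed.

Lemma decomposition_rank_lt i : (0 < \rank (W i) < n)%N.
Proof.
have [I_gt1 nzW _ _ _] := decW.
have rW j : (0 < \rank (W j))%N by rewrite lt0n mxrank_eq0.
rewrite rW -[X in (_ < X)%N]decomposition_rank (bigD1 i) //=.
rewrite -{1}[\rank (W i)]addn0 ltn_add2l.
have [j nji] : exists j, j != i.
  apply/existsP; rewrite -negb_forall; apply: contraL I_gt1 => /forallP eqi.
  rewrite -leqNgt -(card1 i); apply/subset_leq_card/subsetP=> j _.
  by rewrite inE eqi.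
by rewrite (bigD1 j) //= ltn_addr.
Qed.

(** For [g] in [G] the [pick] always succeeds. Outside [G] the default [i] keeps the map injective,
    as an action requires for every [g]. *)
Definition block_act (i : I) (g : gT) : I :=
  if g \in G then odflt i [pick j | (W i *m rG g == W j)%MS] else i.

Lemma block_actP i g : g \in G -> (W i *m rG g :=: W (block_act i g))%MS.
Proof.
move=> Gg; rewrite /block_act Gg; case: pickP => [j /eqmxP //|no_j].
have [_ _ _ _ /(_ g Gg i)[j /eqmxP def_j]] := decW.
by have := no_j j; rewrite /= def_j.
Qed.

Lemma block_act_is_action : is_action G block_act.
Proof.
split=> [g i j | i g h Gg Gh].
  have [Gg|nGg] := boolP (g \in G); last by rewrite /block_act (negPf nGg).
  move=> eq_ij; apply: decomposition_inj.
  rewrite -(submxMfree _ _ (_ : row_free (rG g))) ?repr_mx_free //.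
  by rewrite (block_actP i Gg) (block_actP j Gg) eq_ij.
apply: decomposition_inj; rewrite -(block_actP _ (groupM Gg Gh)) repr_mxM // mulmxA.
by rewrite -(block_actP _ Gh) submxMr // (block_actP _ Gg).
Qed.

Canonical block_action := Action block_act_is_action.

Lemma coarsen_decomposition (Q : {set {set I}}) :
    partition Q [set: I] -> (1 < #|Q|)%N ->
    {in Q & G, forall (B : {set I}) g, actperm block_action g @: B \in Q} ->
  decomposition rG (fun B : {B : {set I} | B \in Q} => (\sum_(i in val B) W i)%MS).
Proof.
move=> partQ Q_gt1 actQ; have [_ nzW sumW dxW _] := decW.
have [/eqP covQ trivQ nQ0] := and3P partQ.
pose W' (B : {B : {set I} | B \in Q}) := (\sum_(i in val B) W i)%MS.
have sumW' : (\sum_B W' B :=: 1%:M)%MS.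
  apply/eqmxP; rewrite submx1 -sumW; apply/sumsmx_subP=> i _.
  have Qi : pblock Q i \in Q by rewrite pblock_mem // covQ.
  apply: (sumsmx_sup (Sub (pblock Q i) Qi)) => //; apply: (sumsmx_sup i) => //=.
  by rewrite mem_pblock covQ.
split.
- by rewrite card_sig (@eq_card _ _ Q).
- move=> [B QB]; have /set0Pn[i Bi] : B != set0 by apply: contraNneq nQ0 => <-.
  apply: contraNneq (nzW i) => /= W'0; rewrite -submx0 -W'0.
  exact: (sumsmx_sup i).
- exact: sumW'.
(* Directness by counting ranks: the merged blocks span a space of rank [n], while their ranks add
   up to at most the sum over the [W i], which is [n]. *)
- apply/mxdirectP/eqP; rewrite eqn_leq mxrank_sum_leqif /= sumW' mxrank1.
  rewrite -[X in (_ <= X)%N]decomposition_rank.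
  apply: leq_trans
    (_ : \sum_(B : {B : {set I} | B \in Q}) \sum_(i in val B) \rank (W i) <= _)%N.
    by apply: leq_sum => B _; rewrite mxrank_sum_leqif.
  rewrite -(big_sub (mem Q) (fun B : {set I} => \sum_(i in B) \rank (W i))%N) /=.
  rewrite -(set_partition_big _ partQ) /=.
  by rewrite (eq_bigl xpredT) // => i; rewrite inE.
move=> g Gg [B QB]; have QBg := actQ B g QB Gg.
exists (Sub (actperm block_action g @: B) QBg) => /=.
apply/eqmxP/andP; split.
  rewrite sumsmxMr; apply/sumsmx_subP=> i Bi; rewrite (block_actP i Gg).
  apply: (sumsmx_sup (block_act i g)) => //.
  by apply/imsetP; exists i; rewrite ?actpermE.
apply/sumsmx_subP=> _ /imsetP[i Bi ->]; rewrite actpermE -(block_actP i Gg) submxMr //.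
exact: (sumsmx_sup i).
Qed.

End BlockAction.

(** * The bound for arbitrary representations *)

Section NotPrimitive.

Local Open Scope ring_scope.

Variables (F : fieldType) (gT : finGroupType) (G : {group gT}) (n : nat).
Variable rG : mx_representation F G n.

(** A proper nonzero submodule has a Maschke complement, and the pair is a decomposition whose two
    blocks are each fixed by [G]. *)
Lemma no_decomposition_primitive :
    (0 < n)%N -> [pchar F]^'.-group G ->
    (forall (I : finType) (W : I -> 'M[F]_n), ~ decomposition rG W) ->
  primitive_repr rG.
Proof.
move=> n_gt0 F'G noW; split=> //; apply/mx_irrP; split=> // U modU nzU.
apply: contraT => nfullU.
have [V modV sumUV dxUV] := mx_Maschke_pchar rG F'G modU (submx1 U).
have bigUV (W := fun b : bool => if b then U else V) : (\sum_b W b = U + V)%MS.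
  by rewrite big_bool.
case: (noW bool (fun b => if b then U else V)); split.
- by rewrite card_bool.
- case=> //; apply: contraNneq nfullU => V0.
  by rewrite -sub1mx -sumUV V0 addsmx0.
- by rewrite bigUV.
- apply/mxdirectP; rewrite /= bigUV big_bool /=; exact: (mxdirectP dxUV).
move=> g Gg b; exists b; apply/eqmxP.
have modW : mxmodule rG (if b then U else V) by case: b.
move: (if b then U else V) modW => X modX; rewrite (mxmoduleP modX) //=.
rewrite -{1}[X](repr_mxKV rG Gg) submxMr //.
by rewrite (mxmoduleP modX) ?groupV.
Qed.

Lemma quo_primitive : primitive_repr rG -> primitive_repr (kquo_repr rG).
Proof.
case=> irrG noW; split; first exact/quo_mx_irr.
move=> I W [I_gt1 nzW sumW dxW actW]; apply: (noW I W); split=> // g Gg i.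
have [|j] := actW (coset (rker rG) g) _ i; first exact: mem_quotient.
by rewrite kquo_repr_coset //; exists j.
Qed.

End NotPrimitive.

(** * Induction on the dimension *)

Section LinearBound.

Variables (q r : nat) (F : finFieldType).
Hypotheses (q_pr : prime q) (r_pr : prime r) (neq_qr : q <> r).
Hypotheses (qF : q \notin [pchar F]%R) (rF : r \notin [pchar F]%R).

(** The index of [rker rG] is the order of the linear image, so the bound also makes sense for the
    unfaithful actions on blocks. *)
Definition linear_bound n (gT : finGroupType) (G : {group gT})
    (rG : mx_representation F G n) :=
  (#|G : rker rG| ^ 2 <= 6 ^ n.-1 * minn (q * r) #|F| ^ (2 * n))%N.

Lemma decomposition_bound n (gT : finGroupType) (G : {group gT})
    (rG : mx_representation F G n) (I : finType) (W : I -> 'M[F]_n) :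
    (forall m (hT : finGroupType) (H : {group hT}) (rH : mx_representation F H m),
      (0 < m < n)%N -> in_AqAr q r H -> linear_bound rH) ->
    in_AqAr q r G -> decomposition rG W ->
  linear_bound rG.
Proof.
(* Inner induction on the number of blocks, over all decompositions for the same [rG]. *)
move=> IHn GAqAr; have [k] := ubnP #|I|.
elim: k => // k IHk in I W * => /ltnSE leIk decW.
have [I_gt1 _ sumW _ _] := decW.
pose f := actperm_morphism (block_action decW).
pose H := (f @* G)%G.
have [|leH | [Q [partQ actQ /andP[Q_gt1 ltQ]]]] := @metabelian_perm_card I H I_gt1.
- by rewrite /= -morphim_der // morphim_abelian // (in_AqAr_der1_abelian GAqAr).
- pose K := ('ker f)%G; have sKG : K \subset G by apply: subset_trans (subsetIl _ _) _.
  pose rK := subg_repr rG sKG.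
  have modW i : mxmodule rK (W i).
    apply/mxmoduleP=> x /[dup] Kx /mker fx.
    rewrite /= (block_actP decW) ?(subsetP sKG) //.
    have -> : block_act rG W i x = i.
      by rewrite -[LHS](actpermE (block_action decW)) [actperm _ _]fx perm1.
    exact: submx_refl.
  pose R i := rker (submod_repr (modW i)).
  have leK : (#|K : rker rG| <= \prod_i #|K : R i|)%N.
    (* An element acting trivially on every block acts trivially on their sum. *)
    apply: (@leq_index_bigcap _ _ _ (rker_group rG) (fun i => rker_group _)).
    apply/subsetP=> x /bigcapP Rx.
    have /card_gt0P[i0 _] := ltnW I_gt1.
    have Kx : x \in K by have := Rx i0 isT; rewrite inE => /andP[].
    apply/rkerP; split; first exact: (subsetP sKG).
    have /sub_sumsmxP[u def1] : ((1%:M)%R <= \sum_i W i)%MS by rewrite sumW.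
    rewrite -[LHS]mul1mx def1 mulmx_suml; apply: eq_bigr => i _.
    have := Rx i isT; rewrite /= rker_submod inE => /andP[_ /eqP/= Wx].
    by rewrite -mulmxA Wx.
  have leG : (#|G : rker rG| <= #|H| * \prod_i #|K : R i|)%N.
    have -> : #|H| = #|G : K| by rewrite card_morphim setIid.
    by apply: leq_trans (leq_index_mul _ sKG) _; rewrite leq_mul.
  have leR i :
      (#|K : R i| ^ 2 <= 6 ^ (\rank (W i)).-1 * minn (q * r) #|F| ^ (2 * \rank (W i)))%N.
    apply: IHn; first exact: decomposition_rank_lt decW i.
    exact: in_AqAr_sub GAqAr.
  have leP :
      ((\prod_i #|K : R i|) ^ 2 <=
       6 ^ (\sum_i (\rank (W i)).-1) * minn (q * r) #|F| ^ (2 * n))%N.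
    rewrite -[X in (2 * X)%N](decomposition_rank decW) big_distrr /= !expn_sum -big_split /=.
    rewrite (big_morph (expn^~ 2) (id1 := 1%N) (op1 := muln)) ?exp1n //.
      exact: leq_prod.
    by move=> x y; apply: expnMn.
  (* Exponents of 6 balance: one is lost in each block, and the permutation group on the blocks
     accounts for [#|I|.-1] of these. *)
  have sum_pred : (#|I|.-1 + \sum_i (\rank (W i)).-1 = n.-1)%N.
    apply: succn_inj; rewrite -addSn prednK ?(ltnW I_gt1) // -sum1_card -big_split /=.
    have -> : (\sum_i (1 + (\rank (W i)).-1) = n)%N.
      rewrite -[RHS](decomposition_rank decW); apply: eq_bigr => i _.
      by rewrite add1n prednK //; case/andP: (decomposition_rank_lt decW i).
    have /card_gt0P[i0 _] := ltnW I_gt1.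
    rewrite prednK //; case/andP: (decomposition_rank_lt decW i0) => _.
    exact: leq_ltn_trans.
  have leH2 : (#|H| ^ 2 <= 6 ^ #|I|.-1)%N.
    apply: leq_trans (sqr_pred_mul_le_exp6 I_gt1).
    by rewrite leq_exp2r.
  have leG2 : (#|G : rker rG| ^ 2 <= (#|H| * \prod_i #|K : R i|) ^ 2)%N.
    by rewrite leq_exp2r.
  apply: leq_trans leG2 _; rewrite expnMn -sum_pred expnD -mulnA.
  exact: leq_mul leH2 leP.
have decQ := coarsen_decomposition partQ Q_gt1.
apply: IHk (decQ _ _ _ _ _ _ decW _).
  by rewrite card_sig (@eq_card _ _ Q) //; apply: leq_trans leIk.
by move=> B g QB Gg; apply: actQ => //; apply: mem_morphim.
Qed.

(** Were the bound to fail, no decomposition could exist, by induction on the dimension. The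
    representation would then be primitive, and the primitive bound applies to the faithful quotient
    by its kernel. *)
Lemma in_AqAr_linear_bound n (gT : finGroupType) (G : {group gT})
    (rG : mx_representation F G n) :
  (0 < n)%N -> in_AqAr q r G -> linear_bound rG.
Proof.
have [N] := ubnP n; elim: N => // N IHN in n gT G rG * => /ltnSE le_nN n_gt0 GAqAr.
apply: contraT => /negP nb.
have primG : primitive_repr rG.
  apply: no_decomposition_primitive (in_AqAr_pchar' q_pr r_pr qF rF GAqAr) _ => //.
  move=> I W decW; apply: nb; apply: decomposition_bound decW => //.
  move=> m hT H rH /andP[m_gt0 ltmn]; apply: IHN => //.
  exact: leq_trans ltmn le_nN.
case: nb; case: n => // n in rG n_gt0 primG le_nN *.
rewrite /linear_bound -card_quotient ?rker_norm //.
apply: primitive_card_bound (quo_primitive primG) (kquo_mx_faithful rG) => //.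
exact: in_AqAr_morphim (rker_norm rG) GAqAr.
Qed.

End LinearBound.

(** * Transfer to subgroups of the general linear group *)

Lemma GL_natrepr_faithful (F : finFieldType) n (G : {group {'GL_n[F]}}) :
  mx_faithful (GL_natrepr G).
Proof.
apply/subsetP=> g /rkerP[_ g1]; rewrite inE; apply/eqP/val_inj; exact: g1.
Qed.

Lemma primitive_linear_repr (F : finFieldType) n (G : {group {'GL_n[F]}}) :
  primitive_linear G -> primitive_repr (GL_natrepr G).
Proof.
case=> irrG noW; split=> // I W [I_gt1 nzW sumW dxW actW]; apply: noW.
pose W' i := W (@enum_val I predT i).
have sumW' : (\sum_i W' i = \sum_i W i)%MS by rewrite [RHS]big_enum_val.
exists #|I|, W'; split=> //.
- by move=> i; apply: nzW.
- by apply/eqmxP; rewrite sumW'.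
- apply/mxdirectP; rewrite /= sumW' (mxdirectP dxW) /=.
  by rewrite [LHS]big_enum_val.
move=> g Gg i; have [j defWj] := actW g Gg (enum_val i).
by exists (enum_rank j); apply/eqmxP; rewrite /W' enum_rankK.
Qed.

Theorem proposition4p1 (R : rcfType) (t q r s e alpha : nat)
    (F : finFieldType) (G : {group {'GL_alpha[F]}})
    (t_pr : prime t) (q_pr : prime q) (r_pr : prime r)
    (tq : t <> q) (tr : t <> r) (qr : q <> r)
    (e_gt0 : (0 < e)%N) (s_def : s = (t ^ e)%N) (cardF : #|F| = s)
    (alpha_gt0 : (0 < alpha)%N)
    (GAqAr : in_AqAr q r G) :
  (forall m : nat, m = #|'F(G)| -> primitive_linear G ->
     (exists c : nat,
        [/\ is_mult_order s m c, (#|G| <= c * m)%N & (c %| alpha)%N])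
     /\ (G <> 1 :> {set {'GL_alpha[F]}} -> [\/ m = r, m = q | m = (q * r)%N]))
  /\
  (#|G|%:R <= Num.sqrt (6%:R : R) ^+ (alpha - 1)%N
              * (minn (q * r) s)%:R ^+ alpha)%R.
Proof.
have tF : t \in [pchar F]%R by apply: card_finPcharP t_pr; rewrite cardF s_def.
have qF : q \notin [pchar F]%R.
  by rewrite (pcharf_eq tF) inE; apply/eqP=> /esym.
have rF : r \notin [pchar F]%R.
  by rewrite (pcharf_eq tF) inE; apply/eqP=> /esym.
have injG := GL_natrepr_faithful G.
split=> [_ -> /primitive_linear_repr primG | ].
  split=> [|ntG]; last first.
    by apply: (primitive_Fitting_card q_pr r_pr qr GAqAr primG injG); apply/eqP.
  have [c c_ord [leG c_dvd]] :=
    primitive_Fitting_order q_pr r_pr qr qF rF GAqAr primG injG.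
  by exists c; rewrite -cardF; split; rewrite // -(prednK alpha_gt0).
have := in_AqAr_linear_bound q_pr r_pr qr qF rF (GL_natrepr G) (ltn0Sn _) GAqAr.
rewrite /linear_bound (trivgP injG) indexg1 prednK // cardF /= subn1 => leG.
(* Both sides are nonnegative, so comparing squares reduces the real inequality to the one in the
   naturals. *)
rewrite -ler_sqr ?nnegrE ?mulr_ge0 ?exprn_ge0 ?sqrtr_ge0 ?ler0n //.
rewrite exprMn -!exprM [(alpha * 2)%N]mulnC [(_ * 2)%N]mulnC exprM sqr_sqrtr ?ler0n //.
by rewrite -!natrX -natrM ler_nat.
Qed.
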